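(* If $R$ is a finite ring then \[ \Pr(R)\ge \frac{1}{|K(R,R)|}\left(1+\frac{|K(R,R)|-1}{|R:Z(R)|}\right). \] In particular, if $R$ is non-commutative then $\Pr(R)>\dfrac{1}{|K(R,R)|}$.
   Context: Rings are associative and are not required to have an identity. For a finite ring $R$: $K(R,R)=\{sr-rs: s,r\in R\}$ (a set, not necessarily a subgroup); $Z(R)$ is the center of $R$; $|R:Z(R)|$ is the index of $Z(R)$ in $(R,+)$; and $\Pr(R)=\dfrac{|\{(s,r)\in R\times R: sr=rs\}|}{|R|^2}$. *)

(* Defs.v *)
From HB Require Import structures.
From mathcomp Require Import all_boot all_order all_fingroup all_algebra.

Set Implicit Arguments.
Unset Strict Implicit.
Unset Printing Implicit Defensive.

Import GRing.Theory.
Local Open Scope ring_scope.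

(* MathComp's ring structures all carry a unit element; a rng is an
   associative ring that is not required to have one. *)
HB.mixin Record Zmodule_isRng R of GRing.Zmodule R := {
  rngmul : R -> R -> R;
  rngmulA : associative rngmul;
  rngmulDl : left_distributive rngmul +%R;
  rngmulDr : right_distributive rngmul +%R
}.

#[short(type="finRngType")]
HB.structure Definition FinRng := { R of Zmodule_isRng R & FinRing.Zmodule R }.

(* As for the other finite algebraic structures, the group law is addition. *)
#[non_forgetful_inheritance]
HB.instance Definition _ (R : finRngType) := [finGroupMixin of R for +%R].
Coercion FinRng_to_baseFinGroup (R : finRngType) := FinStarMonoid.clone R _.
Coercion FinRng_to_finGroup (R : finRngType) := FinGroup.clone R _.

Reserved Notation "x ** y" (at level 40, left associativity).
Notation "x ** y" := (rngmul x y) : ring_scope.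

Definition rng_commutators (R : finRngType) : {set R} :=
  [set s ** r - r ** s | s : R, r : R].

Definition rng_center (R : finRngType) : {set R} :=
  [set z : R | [forall r : R, z ** r == r ** z]].

Lemma rng_center_group_set (R : finRngType) : group_set (rng_center R).
Proof.
have mul0x (r : R) : 0 ** r = 0.
  by apply: (addrI (0 ** r)); rewrite -rngmulDl !addr0.
have mulx0 (r : R) : r ** 0 = 0.
  by apply: (addrI (r ** 0)); rewrite -rngmulDr !addr0.
apply/group_setP; split=> [|x y].
  by rewrite inE FinRing.zmod1gE; apply/forallP => r; rewrite mul0x mulx0.
rewrite !inE FinRing.zmodMgE => /forallP xC /forallP yC; apply/forallP => r.
by rewrite rngmulDl rngmulDr (eqP (xC r)) (eqP (yC r)).
Qed.

Canonical rng_center_group (R : finRngType) : {group R} :=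
  Group (rng_center_group_set R).

Definition rng_center_index (R : finRngType) : nat :=
  #|[set: R] : rng_center R|%g.

Definition commuting_prob (R : finRngType) : rat :=
  #|[set p : R * R | p.1 ** p.2 == p.2 ** p.1]|%:R / (#|R| ^ 2)%:R.

(* Main.v *)
Require Import Defs.
From HB Require Import structures.
From mathcomp Require Import all_boot all_order all_fingroup all_algebra.
From mathcomp Require Import ring.

Set Implicit Arguments.
Unset Strict Implicit.
Unset Printing Implicit Defensive.

Import Order.TTheory GRing.Theory Num.Theory.
Local Open Scope ring_scope.

(** Count the commuting pairs of [R] one first coordinate at a time: their
    number is the sum over [s] of the order of the centralizer [C(s)].  If [s]
    is central, then [C(s)] is all of [R].  In general, [C(s)] is the kernel of
    the additive map [r |-> s ** r - r ** s], whose image lies in [K(R,R)], so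
    [|R| <= |K(R,R)| |C(s)|] ([card_rng_centralizer]).  Summing the first
    estimate over the center and the second over its complement bounds the
    number of commuting pairs ([card_commuting_pairs]); division by [|R|^2],
    together with Lagrange's theorem [|R| = |Z(R)| |R : Z(R)|], gives the stated
    inequality.  When [R] is not commutative, [K(R,R)] contains a nonzero
    element besides 0, so [(|K(R,R)| - 1) / |R : Z(R)|] is positive and the
    second claim follows. *)

Definition rng_centralizer (R : finRngType) (s : R) : {set R} :=
  [set r | s ** r == r ** s].

Lemma rngmulBl (R : finRngType) (x y z : R) :
  (x - y) ** z = x ** z - y ** z.
Proof. by apply: (addIr (y ** z)); rewrite -rngmulDl !subrK. Qed.

Lemma rngmulBr (R : finRngType) (x y z : R) :
  z ** (x - y) = z ** x - z ** y.
Proof. by apply: (addIr (z ** y)); rewrite -rngmulDr !subrK. Qed.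

(** Two elements with the same commutator with [s] differ by an element of the
    centralizer of [s], so every nonempty fiber of [r |-> s ** r - r ** s] is
    contained in a translate of that centralizer. *)
Lemma card_rng_commutator_fiber (R : finRngType) (s k : R) :
  (#|[set r | s ** r - r ** s == k]%R| <= #|rng_centralizer s|)%N.
Proof.
have [-> | [r0]] := set_0Vmem [set r | s ** r - r ** s == k].
  by rewrite cards0.
rewrite inE => /eqP r0k; rewrite -(card_imset _ (addIr (- r0))).
apply/subset_leq_card/subsetP => _ /imsetP[r + ->].
rewrite !inE rngmulBl rngmulBr -r0k => /eqP rk.
by rewrite -subr_eq0 opprB [_ ** _ - r ** s]addrC addrACA rk
           [- _ + _]addrC -opprB addNr.
Qed.

Lemma card_rng_centralizer (R : finRngType) (s : R) :
  (#|R| <= #|rng_commutators R| * #|rng_centralizer s|)%N.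
Proof.
rewrite -sum_nat_const -[leqLHS]sum1_card.
rewrite (partition_big (fun r => s ** r - r ** s) (mem (rng_commutators R))) /=;
  last by move=> r _; apply: imset2_f.
apply: leq_sum => k _; rewrite sum1_card -cardsE.
exact: card_rng_commutator_fiber.
Qed.

Lemma rng_centralizer_center (R : finRngType) (s : R) :
  s \in rng_center R -> rng_centralizer s = [set: R].
Proof.
by rewrite inE => /forallP sZ; apply/setP => r; rewrite !inE sZ.
Qed.

Lemma card_commuting_pairs_sum (R : finRngType) :
  #|[set p : R * R | p.1 ** p.2 == p.2 ** p.1]%R| =
  (\sum_(s : R) #|rng_centralizer s|)%N.
Proof.
rewrite -sum1_card (eq_bigl (fun p : R * R => p.1 ** p.2 == p.2 ** p.1));
  last by move=> p; rewrite inE.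
rewrite -(pair_big_dep predT (fun s r : R => s ** r == r ** s) (fun _ _ => 1%N)).
by apply: eq_bigr => s _; rewrite sum1_card cardsE.
Qed.

(** Both sides are multiplied by [|K(R,R)|] so that the estimate on
    noncentral elements needs no division. *)
Lemma card_commuting_pairs (R : finRngType) :
  (#|rng_center R| * (#|rng_commutators R| * #|R|)
     + #|~: rng_center R| * #|R|
   <= #|rng_commutators R|
      * #|[set p : R * R | p.1 ** p.2 == p.2 ** p.1]%R|)%N.
Proof.
rewrite card_commuting_pairs_sum big_distrr /= (bigID (mem (rng_center R))) /=.
apply: leq_add; rewrite -sum_nat_const.
  by apply: leq_sum => s sZ; rewrite rng_centralizer_center // cardsT.
rewrite (eq_bigl (fun s => s \notin rng_center R)) => [|s]; last first.
  by rewrite in_setC.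
by apply: leq_sum => s _; apply: card_rng_centralizer.
Qed.

Lemma rng_commutators0 (R : finRngType) : 0 \in rng_commutators R.
Proof. by rewrite -(subrr (0 ** 0 : R)); apply: imset2_f. Qed.

Lemma card_rng_commutators_gt1 (R : finRngType) :
  ~ commutative (@rngmul R) -> (1 < #|rng_commutators R|)%N.
Proof.
move=> ncR; rewrite ltnNge; apply/negP => /card_le1_eqP K1; apply: ncR => s r.
apply/eqP; rewrite -subr_eq0; apply/eqP.
by apply: K1; [apply: rng_commutators0 | apply: imset2_f].
Qed.

Lemma card_rng_center_index (R : finRngType) :
  (#|rng_center R| * rng_center_index R)%N = #|R|.
Proof.
by rewrite -[RHS]cardsT; apply: (@Lagrange R [set: R]%G (rng_center_group R));
   apply: subsetT.
Qed.

Theorem corollary2p18 (R : finRngType) :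
  commuting_prob R >=
    1 / #|rng_commutators R|%:R *
      (1 + (#|rng_commutators R|%:R - 1) / (rng_center_index R)%:R)
  /\ (~ commutative (@rngmul R) ->
      commuting_prob R > 1 / #|rng_commutators R|%:R).
Proof.
have K_gt0 : (0 < #|rng_commutators R|)%N.
  by apply/card_gt0P; exists 0; apply: rng_commutators0.
have R_gt0 : (0 < #|R|)%N by apply/card_gt0P; exists 0.
have ZiR := card_rng_center_index R.
have /andP[Z_gt0 i_gt0] : (0 < #|rng_center R|)%N && (0 < rng_center_index R)%N.
  by rewrite -muln_gt0 ZiR.
have bound : 1 / #|rng_commutators R|%:R *
      (1 + (#|rng_commutators R|%:R - 1) / (rng_center_index R)%:R)
    <= commuting_prob R.
  have := card_commuting_pairs R.
  rewrite -(ler_nat rat) natrD !natrM => count.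
  have compl : #|~: rng_center R|%:R = #|R|%:R - #|rng_center R|%:R :> rat.
    by rewrite -(cardsC (rng_center R)) natrD addrC addKr.
  rewrite /commuting_prob ler_pdivlMr ?ltr0n ?expn_gt0 ?R_gt0 //.
  rewrite -(ler_pM2l (_ : 0 < #|rng_commutators R|%:R)) ?ltr0n //.
  (* The two sides agree once |R| is written as |Z(R)| |R : Z(R)|. *)
  apply: le_trans count; rewrite compl natrX -ZiR natrM le_eqVlt.
  apply/orP; left; apply/eqP; field.
  by rewrite !pnatr_eq0 -!lt0n K_gt0 i_gt0.
split=> // /card_rng_commutators_gt1 K_gt1; apply: lt_le_trans bound.
rewrite ltr_pMr ?divr_gt0 ?ltr0n // ltrDl divr_gt0 ?ltr0n //.
by rewrite subr_gt0 ltr1n.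
Qed.
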